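(* Let $R$ be a superalgebra over $\mathbb Q$. The map $\hat E$ from $(R^0)^\times\times R^\infty$ to the set of all formal superconformal power series $H(x,\varphi)$ of the form $$\varphi H(x,\varphi)=\varphi\Big(a_\square^2\Big(x+\sum_{j\ge1}a_jx^{j+1}\Big),\ a_\square\sum_{j\ge1}m_{j-\frac12}x^j\Big)$$ and with even coefficient of $\varphi$ equal to $a_\square$, for $(a_\square,a,m)\in(R^0)^\times\times R^\infty$, is a bijection. The map $\tilde E$ from $R^\infty$ to the set of formal superconformal power series of this form with $a_\square=1$ and even coefficient of $\varphi$ equal to $1$ is also a bijection. In particular, there are inverses $\tilde E^{-1}$ and $\hat E^{-1}$.
   Context: A superalgebra $R=R^0\oplus R^1$ over $\mathbb Q$ is a $\mathbb Z_2$-graded associative unital $\mathbb Q$-algebra with $ab=(-1)^{|a||b|}ba$ for homogeneous $a,b$; $(R^0)^\times$ is the set of invertible even elements. $x$ is an even and $\varphi$ an odd formal variable ($\varphi^2=0$, $\varphi$ anticommutes with odd elements). $R^\infty$ is the set of pairs of sequences $\{(A_j,M_{j-1/2})\}_{j\ge1}$ with $A_j\in R^0$, $M_{j-1/2}\in R^1$. A formal power series in $R[[x]][\varphi]$ is written as a pair $H(x,\varphi)=(f(x)+\varphi\xi(x),\psi(x)+\varphi g(x))$ ($f,g$ with even, $\xi,\psi$ with odd coefficients); it is superconformal if $\xi=g\psi$, $g^2=f'+\psi\psi'$, $g+\varphi\psi'\not\equiv0$. Thus $\varphi H=\varphi(f,\psi)$. The even coefficient of $\varphi$ is the coefficient $g(0)$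 of the monomial $\varphi$ in the odd part. For $j\ge1$: $L_j(x,\varphi)=-(x^{j+1}\frac{\partial}{\partial x}+\frac{j+1}2\varphi x^j\frac{\partial}{\partial\varphi})$, $G_{j-\frac12}(x,\varphi)=-x^j(\frac{\partial}{\partial\varphi}-\varphi\frac{\partial}{\partial x})$. The elements $E_j(A,M)\in R^0$, $E_{j-1/2}(A,M)\in R^1$ are defined by $$\varphi\Big(x+\sum_{j\ge1}E_j(A,M)x^{j+1},\sum_{j\ge1}E_{j-\frac12}(A,M)x^j\Big)=\varphi\exp\Big(-\sum_{j\ge1}(A_jL_j(x,\varphi)+M_{j-\frac12}G_{j-\frac12}(x,\varphi))\Big)\cdot(x,\varphi).$$ $\tilde E(A,M)(x,\varphi)=(\tilde E^0,\tilde E^1)$ is the unique formal superconformal power series with even coefficient of $\varphi$ equal to one such that $\varphi\tilde E(A,M)=\varphi(x+\sum_{j\ge1}E_j(A,M)x^{j+1},\sum_{j\ge1}E_{j-1/2}(A,M)x^j)$, and $\hat E(a_\square,A,M)(x,\varphi)=(a_\square^2\tilde E^0(A,M)(x,\varphi),\,a_\square\tilde E^1(A,M)(x,\varphi))$. *)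

(* Defs.v *)
From HB Require Import structures.
From mathcomp Require Import all_boot all_order all_algebra.
From mathcomp Require Import all_classical.
From mathcomp Require Import zify.

Set Implicit Arguments.
Unset Strict Implicit.
Unset Printing Implicit Defensive.

Import GRing.Theory.
Local Open Scope ring_scope.
Local Open Scope classical_set_scope.

(* [homog false] is the even part and [homog true] the odd part.  The carrier  *)
(* is an [algType], hence nontrivial (1 != 0): over the zero algebra no series *)
(* is superconformal, because of the condition g + phi psi' != 0.              *)
Record superalgebra := Superalgebra {
  superalg_sort :> algType rat;
  homog : bool -> submodClosed superalg_sort;
  homog_split : forall r : superalg_sort,
    exists r0, (r0 \in homog false) && (r - r0 \in homog true);
  homog_cap : forall r : superalg_sort,
    r \in homog false -> r \in homog true -> r = 0;
  homog1 : 1 \in homog false;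
  homogM : forall (p q : bool) (a b : superalg_sort),
    a \in homog p -> b \in homog q -> a * b \in homog (p (+) q);
  supercomm : forall (p q : bool) (a b : superalg_sort),
    a \in homog p -> b \in homog q -> a * b = (-1) ^+ (p && q) * (b * a)
}.

Definition even_part (R : superalgebra) (r : R) : R := xchoose (homog_split r).
Definition odd_part (R : superalgebra) (r : R) : R := r - even_part r.

(* Locked only to keep unification from seeing it as a difference. *)
HB.lock Definition parity (R : superalgebra) (r : R) : R :=
  even_part r - odd_part r.
Arguments parity {R} r.

Section Parity.
Variable R : superalgebra.
Implicit Types r s : R.

Lemma even_part_homog r : even_part r \in homog R false.
Proof. by case/andP: (xchooseP (homog_split r)). Qed.

Lemma odd_part_homog r : odd_part r \in homog R true.
Proof. by case/andP: (xchooseP (homog_split r)). Qed.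

Lemma homogN p r : r \in homog R p -> - r \in homog R p.
Proof. by move=> hr; rewrite -scaleN1r rpredZ. Qed.

Lemma homogB p r s : r \in homog R p -> s \in homog R p -> r - s \in homog R p.
Proof. by move=> hr hs; rewrite rpredD ?homogN. Qed.

Lemma even_part_unique r r0 r1 :
  r0 \in homog R false -> r1 \in homog R true -> r = r0 + r1 -> even_part r = r0.
Proof.
move=> h0 h1 e; apply/eqP; rewrite -subr_eq0; apply/eqP/homog_cap.
  exact: homogB (even_part_homog r) h0.
have -> : even_part r - r0 = r1 - odd_part r.
  by rewrite /odd_part opprB addrCA; congr (_ + _); rewrite e opprD addrCA subrr addr0.
exact: homogB h1 (odd_part_homog r).
Qed.

Lemma parityE r0 r1 : r0 \in homog R false -> r1 \in homog R true ->
  parity (r0 + r1) = r0 - r1.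
Proof.
move=> h0 h1; rewrite unlock /odd_part (even_part_unique h0 h1 erefl).
by rewrite addrAC subrr add0r.
Qed.

Lemma even_odd r : r = even_part r + odd_part r.
Proof. by rewrite /odd_part addrC subrK. Qed.

Lemma parity_even r : r \in homog R false -> parity r = r.
Proof.
by move=> h; have := parityE h (rpred0 (homog R true)); rewrite addr0 subr0.
Qed.

Lemma parity_odd r : r \in homog R true -> parity r = - r.
Proof.
by move=> h; have := parityE (rpred0 (homog R false)) h; rewrite add0r sub0r.
Qed.

Lemma parityD : {morph @parity R : r s / r + s}.
Proof.
move=> r s; rewrite {1}(even_odd r) {1}(even_odd s) addrACA parityE.
- by rewrite unlock opprD addrACA.
- by rewrite rpredD ?even_part_homog.
- by rewrite rpredD ?odd_part_homog.
Qed.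

Lemma parity0 : @parity R 0 = 0.
Proof. exact/parity_even/rpred0. Qed.

Lemma parity_sum (I : Type) (t : seq I) (P : pred I) (F : I -> R) :
  parity (\sum_(i <- t | P i) F i) = \sum_(i <- t | P i) parity (F i).
Proof. exact: (big_morph _ parityD parity0). Qed.

Lemma parityZ (c : rat) r : parity (c *: r) = c *: parity r.
Proof.
rewrite {1}(even_odd r) scalerDr parityE ?rpredZ //.
- by rewrite -scalerBr unlock.
- exact: even_part_homog.
- exact: odd_part_homog.
Qed.

Lemma parityM : {morph @parity R : r s / r * s}.
Proof.
suff parM (r0 r1 s0 s1 : R) : r0 \in homog R false -> r1 \in homog R true ->
    s0 \in homog R false -> s1 \in homog R true ->
    parity ((r0 + r1) * (s0 + s1)) = (r0 - r1) * (s0 - s1).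
  move=> r s; rewrite {1}(even_odd r) {1}(even_odd s).
  by rewrite parM ?even_part_homog ?odd_part_homog // unlock.
move=> a0 a1 b0 b1; rewrite mulrDl !mulrDr !parityD.
rewrite (parity_even (homogM a0 b0)) (parity_odd (homogM a0 b1)).
rewrite (parity_odd (homogM a1 b0)) (parity_even (homogM a1 b1)).
by rewrite !mulrBl !mulrN opprK -!addrA; congr (_ + _); rewrite addrCA.
Qed.

Lemma parity1 : @parity R 1 = 1.
Proof. exact/parity_even/homog1. Qed.

End Parity.

(* R[[x]]: [f n] is the coefficient of x^n. *)
Definition fps (A : algType rat) : Type := nat -> A.

Section FormalPowerSeries.
Variable A : algType rat.
Implicit Types f g h : fps A.

HB.instance Definition _ := GRing.Lmodule.copy (fps A) (nat -> A).

Definition fpsC (a : A) : fps A := fun n => a *+ (n == 0)%N.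
Definition fpsX : fps A := fun n => (n == 1)%:R.
Definition fps_mul f g : fps A := fun n => \sum_(i < n.+1) f i * g (n - i)%N.
Definition fps_deriv f : fps A := fun n => f n.+1 *+ n.+1.

Let trunc n f : {poly A} := \poly_(i < n.+1) f i.

Let truncE n f i : (i <= n)%N -> (trunc n f)`_i = f i.
Proof. by move=> le_in; rewrite coef_poly ltnS le_in. Qed.

Let trunc_mul n m f g : (n <= m)%N -> fps_mul f g n = (trunc m f * trunc m g)`_n.
Proof.
move=> le_nm; rewrite coefM; apply: eq_bigr => i _.
by rewrite !truncE // ?(leq_trans (leq_subr _ _)) // (leq_trans _ le_nm) // -ltnS.
Qed.

Let trunc_trunc_mul n f g i : (i <= n)%N ->
  (trunc n (fps_mul f g))`_i = (trunc n f * trunc n g)`_i.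
Proof. by move=> le_in; rewrite truncE // (trunc_mul (m := n)). Qed.

Fact fps_mulA : associative fps_mul.
Proof.
move=> f g h; apply/funext => n; rewrite !(trunc_mul _ _ (leqnn n)).
transitivity ((trunc n f * (trunc n g * trunc n h))`_n).
  rewrite !coefM; apply: eq_bigr => i _; congr (_ * _).
  by rewrite trunc_trunc_mul // leq_subr.
rewrite mulrA [LHS]coefM [RHS]coefM; apply: eq_bigr => i _; congr (_ * _).
by rewrite trunc_trunc_mul // -ltnS.
Qed.

Fact fps_mul1 : left_id (fpsC 1) fps_mul.
Proof.
move=> f; apply/funext => n; rewrite /fps_mul big_ord_recl /= subn0.
by rewrite /fpsC eqxx mulr1n mul1r big1 ?addr0 // => i _; rewrite mulr0n mul0r.
Qed.

Fact fps_mulr1 : right_id (fpsC 1) fps_mul.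
Proof.
move=> f; apply/funext => n; rewrite /fps_mul big_ord_recr /= subnn.
rewrite /fpsC eqxx mulr1n mulr1 big1 ?add0r // => i _.
by rewrite subn_eq0 leqNgt ltn_ord mulr0n mulr0.
Qed.

Fact fps_mulDl : left_distributive fps_mul +%R.
Proof.
move=> f g h; apply/funext => n; rewrite [RHS]/GRing.add /= /fps_mul -big_split /=.
by apply: eq_bigr => i _; rewrite -mulrDl.
Qed.

Fact fps_mulDr : right_distributive fps_mul +%R.
Proof.
move=> f g h; apply/funext => n; rewrite [RHS]/GRing.add /= /fps_mul -big_split /=.
by apply: eq_bigr => i _; rewrite -mulrDr.
Qed.

Fact fps_one_neq0 : fpsC 1 != 0.
Proof.
by apply/eqP => /(congr1 (fun f => f 0%N)); apply/eqP; rewrite oner_eq0.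
Qed.

HB.instance Definition _ := GRing.Zmodule_isNzRing.Build (fps A)
  fps_mulA fps_mul1 fps_mulr1 fps_mulDl fps_mulDr fps_one_neq0.

Fact fps_scalerAl (c : rat) f g : c *: (f * g) = (c *: f) * g.
Proof.
apply/funext => n; transitivity (c *: \sum_(i < n.+1) f i * g (n - i)%N) => //.
by rewrite scaler_sumr; apply: eq_bigr => i _; rewrite scalerAl.
Qed.

HB.instance Definition _ :=
  GRing.Lmodule_isLalgebra.Build rat (fps A) fps_scalerAl.

Fact fps_scalerAr (c : rat) f g : c *: (f * g) = f * (c *: g).
Proof.
apply/funext => n; transitivity (c *: \sum_(i < n.+1) f i * g (n - i)%N) => //.
by rewrite scaler_sumr; apply: eq_bigr => i _; rewrite scalerAr.
Qed.

HB.instance Definition _ :=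
  GRing.Lalgebra_isAlgebra.Build rat (fps A) fps_scalerAr.

Lemma coef_fpsM f g n : (f * g) n = \sum_(i < n.+1) f i * g (n - i)%N.
Proof. by []. Qed.

Lemma coef_fpsCM a f n : (fpsC a * f) n = a * f n.
Proof.
rewrite coef_fpsM big_ord_recl /= subn0 /fpsC eqxx mulr1n big1 ?addr0 // => i _.
by rewrite mulr0n mul0r.
Qed.

Lemma coef_fpsXM f n : (fpsX * f) n = if n is n'.+1 then f n' else 0.
Proof.
rewrite coef_fpsM; case: n => [|n]; first by rewrite big_ord1 mul0r.
rewrite big_ord_recl /= mul0r add0r big_ord_recl /= subSS subn0 mul1r.
by rewrite big1 ?addr0 // => i _; rewrite mul0r.
Qed.

Lemma coef_fpsXnM k f n : (fpsX ^+ k * f) n = if (n < k)%N then 0 else f (n - k)%N.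
Proof.
elim: k n => [|k IHk] n; first by rewrite mul1r subn0.
by rewrite exprS -mulrA coef_fpsXM; case: n => // n; rewrite IHk ltnS subSS.
Qed.

End FormalPowerSeries.

(* R[[x]][phi]: the pair (u, v) stands for u + phi v, with the coefficients of *)
(* v written to the right of phi.  Since phi anticommutes with odd elements,   *)
(* u phi = phi (parity u), whence the product below.                           *)
Definition sseries (R : superalgebra) : Type := (fps R * fps R)%type.

Section SuperSeries.
Variable R : superalgebra.
Implicit Types (f u v : fps R) (h k : sseries R).

HB.instance Definition _ := GRing.Lmodule.copy (sseries R) (fps R * fps R)%type.

Definition fps_parity f : fps R := fun n => parity (f n).

Definition sseries_mul h k : sseries R :=
  (h.1 * k.1, fps_parity h.1 * k.2 + h.2 * k.1).

Fact fps_parityD : {morph fps_parity : u v / u + v}.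
Proof. by move=> u v; apply/funext => n; apply: parityD. Qed.

Fact fps_parityM : {morph fps_parity : u v / u * v}.
Proof.
move=> u v; apply/funext => n; rewrite /fps_parity !coef_fpsM parity_sum.
by apply: eq_bigr => i _; apply: parityM.
Qed.

Fact fps_parity1 : fps_parity 1 = 1.
Proof.
by apply/funext => -[|n]; [apply: parity1 | apply: parity0].
Qed.

Fact sseries_mulA : associative sseries_mul.
Proof.
move=> h k l; congr (_, _) => /=; first by rewrite mulrA.
by rewrite fps_parityM mulrDr mulrDl !mulrA addrA.
Qed.

Fact sseries_mul1 : left_id (1, 0) sseries_mul.
Proof.
by case=> u v; rewrite /sseries_mul /= fps_parity1 !mul1r mul0r addr0.
Qed.

Fact sseries_mulr1 : right_id (1, 0) sseries_mul.
Proof. by case=> u v; rewrite /sseries_mul /= !mulr1 mulr0 add0r. Qed.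

Fact sseries_mulDl : left_distributive sseries_mul +%R.
Proof.
move=> h k l; congr (_, _) => /=; first by rewrite mulrDl.
by rewrite fps_parityD !mulrDl addrACA.
Qed.

Fact sseries_mulDr : right_distributive sseries_mul +%R.
Proof.
move=> h k l; congr (_, _) => /=; first by rewrite mulrDr.
by rewrite !mulrDr addrACA.
Qed.

Fact sseries_one_neq0 : (1, 0) != 0 :> sseries R.
Proof. by apply/eqP => -[] /eqP; rewrite oner_eq0. Qed.

HB.instance Definition _ := GRing.Zmodule_isNzRing.Build (sseries R)
  sseries_mulA sseries_mul1 sseries_mulr1 sseries_mulDl sseries_mulDr
  sseries_one_neq0.

Definition sC (r : R) : sseries R := (fpsC r, 0).
Definition sX : sseries R := (fpsX R, 0).
Definition phi : sseries R := (0, 1).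

(* Both derivatives act from the left: d/dphi (u + phi v) = v. *)
Definition dx h : sseries R := (fps_deriv h.1, fps_deriv h.2).
Definition dphi h : sseries R := (h.2, 0).

(* Infinite sums of formal series: every coefficient of the partial sums is    *)
(* eventually constant.                                                        *)
Definition is_formal_sum (F : nat -> sseries R) (s : sseries R) : Prop :=
  forall n, exists N, forall m, (N <= m)%N ->
    (\sum_(k < m) F k).1 n = s.1 n /\ (\sum_(k < m) F k).2 n = s.2 n.

Definition formal_sum (F : nat -> sseries R) : sseries R :=
  xget 0 [set s | is_formal_sum F s].

Definition formal_exp (D : sseries R -> sseries R) h : sseries R :=
  formal_sum (fun n => (n`!%:R^-1 : rat) *: iter n D h).

Lemma coefD1 h k n : (h + k).1 n = h.1 n + k.1 n. Proof. by []. Qed.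
Lemma coefD2 h k n : (h + k).2 n = h.2 n + k.2 n. Proof. by []. Qed.
Lemma coefZ1 (c : rat) h n : (c *: h).1 n = c *: h.1 n. Proof. by []. Qed.
Lemma coefZ2 (c : rat) h n : (c *: h).2 n = c *: h.2 n. Proof. by []. Qed.

Lemma is_formal_sum_unique F (s t : sseries R) :
  is_formal_sum F s -> is_formal_sum F t -> s = t.
Proof.
move=> hs ht; rewrite (surjective_pairing s) (surjective_pairing t).
by congr (_, _); apply/funext => n; have [N1 h1] := hs n; have [N2 h2] := ht n;
  have [e1 e2] := h1 _ (leq_maxl N1 N2); have [e3 e4] := h2 _ (leq_maxr N1 N2);
  rewrite -?e1 -?e2 ?e3 ?e4.
Qed.

Lemma formal_sumE F s : is_formal_sum F s -> formal_sum F = s.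
Proof.
by move=> hs; apply: xget_unique => // t ht; apply: is_formal_sum_unique ht hs.
Qed.

Lemma coef_sum_recr (F : nat -> sseries R) m n :
  ((\sum_(i < m.+1) F i).1 n = (\sum_(i < m) F i).1 n + (F m).1 n) *
  ((\sum_(i < m.+1) F i).2 n = (\sum_(i < m) F i).2 n + (F m).2 n).
Proof. by rewrite big_ord_recr. Qed.

Definition summable (F : nat -> sseries R) : Prop :=
  forall n, exists N, forall i, (N <= i)%N -> (F i).1 n = 0 /\ (F i).2 n = 0.

Lemma coef_sseries_sum m (F : nat -> sseries R) n :
  (\sum_(i < m) F i).1 n = \sum_(i < m) (F i).1 n /\
  (\sum_(i < m) F i).2 n = \sum_(i < m) (F i).2 n.
Proof.
elim: m => [|m [IH1 IH2]]; first by rewrite !big_ord0.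
by rewrite !coef_sum_recr !big_ord_recr /= -IH1 -IH2.
Qed.

Lemma summable_is_formal_sum F : summable F -> is_formal_sum F (formal_sum F).
Proof.
move=> /choice[N hN].
set s : sseries R := (fun n => (\sum_(i < N n) F i).1 n,
                      fun n => (\sum_(i < N n) F i).2 n).
suff hs : is_formal_sum F s by rewrite (formal_sumE hs).
move=> n; exists (N n) => m /subnKC <-; rewrite /s /=.
elim: (m - N n)%N => [|d [IH1 IH2]]; first by rewrite addn0.
have [e1 e2] := hN n (N n + d)%N (leq_addr _ _).
by rewrite addnS !coef_sum_recr e1 e2 !addr0.
Qed.

Lemma coef_formal_sum F n N : summable F ->
  (forall i, (N <= i)%N -> (F i).1 n = 0 /\ (F i).2 n = 0) ->
  (formal_sum F).1 n = \sum_(i < N) (F i).1 n /\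
  (formal_sum F).2 n = \sum_(i < N) (F i).2 n.
Proof.
move=> /summable_is_formal_sum /(_ n)[N' hN'] hN.
have [<- <-] := hN' _ (leq_addl N N').
elim: N' {hN'} => [|d [<- <-]]; first by rewrite addn0; apply: coef_sseries_sum.
have [e1 e2] := hN (N + d)%N (leq_addr _ _).
by rewrite addnS !coef_sum_recr e1 e2 !addr0.
Qed.

Lemma phiM h : phi * h = (0, h.1).
Proof.
congr (_, _) => /=; first by rewrite mul0r.
rewrite mul1r; suff -> : fps_parity 0 = 0 by rewrite mul0r add0r.
by apply/funext => n; apply: parity0.
Qed.

Lemma sXnM j h : sX ^+ j * h = (fpsX R ^+ j * h.1, fpsX R ^+ j * h.2).
Proof.
elim: j h => [|j IHj] h; first by rewrite !mul1r -surjective_pairing.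
have sXM (k : sseries R) : sX * k = (fpsX R * k.1, fpsX R * k.2).
  congr (_, _) => /=; rewrite mul0r addr0; congr (_ * _).
  apply/funext => n; rewrite /fps_parity /fpsX.
  by case: eqP => _; [apply: parity1 | apply: parity0].
by rewrite !exprSr -!mulrA sXM IHj.
Qed.

Lemma sCM r h : sC r * h = (fpsC r * h.1, fpsC (parity r) * h.2).
Proof.
congr (_, _) => /=; rewrite mul0r addr0; congr (_ * _).
apply/funext => n; rewrite /fps_parity /fpsC.
by case: eqP => _; rewrite ?mulr1n ?mulr0n ?parity0.
Qed.

Lemma sCXn r j n : (sC r * sX ^+ j).1 n = r *+ (n == j) /\ (sC r * sX ^+ j).2 n = 0.
Proof.
rewrite sCM -(mulr1 (sX ^+ j)) sXnM /= !mulr0; split=> //.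
rewrite coef_fpsCM coef_fpsXnM.
case: ltngtP => [||->]; rewrite ?mulr0 ?subnn ?mulr1 // => lt_jn.
by rewrite /GRing.one /= /fpsC subn_eq0 leqNgt lt_jn mulr0.
Qed.

Definition opL (j : nat) h : sseries R :=
  - (sX ^+ j.+1 * dx h + (j.+1%:R / 2%:R : rat) *: (phi * sX ^+ j * dphi h)).

(* [opG j] is G_{j - 1/2}. *)
Definition opG (j : nat) h : sseries R :=
  - (sX ^+ j * (dphi h - phi * dx h)).

(* A pair of sequences indexed by j >= 1 is stored from index 0: [A i] is      *)
(* A_{i+1} and [M i] is M_{i+1/2}.                                             *)
Definition Rinf : set ((nat -> R) * (nat -> R)) :=
  [set AM | forall i, AM.1 i \in homog R false /\ AM.2 i \in homog R true].

Definition even_units : set R :=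
  [set a | a \in homog R false /\
    exists2 b, b \in homog R false & a * b = 1 /\ b * a = 1].

Definition opT (AM : (nat -> R) * (nat -> R)) h : sseries R :=
  formal_sum (fun i => sC (AM.1 i) * opL i.+1 h + sC (AM.2 i) * opG i.+1 h).

Definition expT AM h : sseries R := formal_exp (fun k => - opT AM k) h.

(* [coefE_even AM i] is E_{i+1}(A, M) and [coefE_odd AM i] is E_{i+1/2}(A, M); *)
(* see [phi_expT] for their defining identity.                                 *)
Definition coefE_even AM (i : nat) : R := (expT AM sX).1 i.+2.
Definition coefE_odd AM (i : nat) : R := (expT AM phi).1 i.+1.

Definition even_series (a : nat -> R) : sseries R :=
  sX + formal_sum (fun i => sC (a i) * sX ^+ i.+2).
Definition odd_series (m : nat -> R) : sseries R :=
  formal_sum (fun i => sC (m i) * sX ^+ i.+1).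

Lemma even_seriesE (a : nat -> R) :
  even_series a = ((fun n => if n is n'.+1 then if n' is i.+1 then a i else 1 else 0), 0).
Proof.
have hn n i : (n <= i)%N ->
    (sC (a i) * sX ^+ i.+2).1 n = 0 /\ (sC (a i) * sX ^+ i.+2).2 n = 0.
  by move=> le_ni; have [-> ->] := sCXn (a i) i.+2 n; rewrite ltn_eqF // ltnS ltnW.
have hs : summable (fun i => sC (a i) * sX ^+ i.+2).
  by move=> n; exists n => i; apply: hn.
rewrite /even_series (surjective_pairing (formal_sum _)).
congr (_, _); apply/funext => n; have [e1 e2] := coef_formal_sum hs (@hn n);
  rewrite [LHS]/GRing.add /= ?e1 ?e2.
- under eq_bigr => i _ do rewrite (sCXn (a i) i.+2 n).1.
  case: n {e1 e2} => [|[|n]]; rewrite /fpsX /=; first by rewrite big_ord0 addr0.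
    by rewrite big1 ?addr0.
  rewrite add0r (bigD1 (inord n)) //= inordK // eqxx big1 ?addr0 // => i.
  by rewrite -val_eqE /= inordK // !eqSS eq_sym => /negPf ->.
- by rewrite big1 ?addr0 // => i _; rewrite (sCXn (a i) i.+2 n).2.
Qed.

Lemma odd_seriesE (m : nat -> R) :
  odd_series m = ((fun n => if n is i.+1 then m i else 0), 0).
Proof.
have hn n i : (n <= i)%N ->
    (sC (m i) * sX ^+ i.+1).1 n = 0 /\ (sC (m i) * sX ^+ i.+1).2 n = 0.
  by move=> le_ni; have [-> ->] := sCXn (m i) i.+1 n; rewrite ltn_eqF.
have hs : summable (fun i => sC (m i) * sX ^+ i.+1).
  by move=> n; exists n => i; apply: hn.
rewrite /odd_series (surjective_pairing (formal_sum _)).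
congr (_, _); apply/funext => n; have [e1 e2] := coef_formal_sum hs (@hn n).
- rewrite e1; under eq_bigr => i _ do rewrite (sCXn (m i) i.+1 n).1.
  case: n {e1 e2} => [|n]; first by rewrite big_ord0.
  rewrite (bigD1 (inord n)) //= inordK ?ltnS // eqxx big1 ?addr0 // => i.
  by rewrite -val_eqE /= inordK ?ltnS // eqSS eq_sym => /negPf ->.
- by rewrite e2 big1 // => i _; rewrite (sCXn (m i) i.+1 n).2.
Qed.

(* Order for the grading in which x has weight 2 and phi has weight 1. *)
Definition ord_ge (w : nat) h : Prop := forall n,
  ((n.*2 < w)%N -> h.1 n = 0) /\ ((n.*2.+1 < w)%N -> h.2 n = 0).

Lemma ord_ge_le w w' h : (w <= w')%N -> ord_ge w' h -> ord_ge w h.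
Proof.
by move=> le_w hh n; have [h1 h2] := hh n; split=> lt_w;
  [apply: h1 | apply: h2]; apply: leq_trans le_w.
Qed.

Lemma ord_geD w h k : ord_ge w h -> ord_ge w k -> ord_ge w (h + k).
Proof.
move=> hh hk n; have [h1 h2] := hh n; have [k1 k2] := hk n.
by rewrite coefD1 coefD2; split=> lt_w; rewrite ?(h1 lt_w) ?(k1 lt_w) ?(h2 lt_w) ?(k2 lt_w) addr0.
Qed.

Lemma ord_geZ w (c : rat) h : ord_ge w h -> ord_ge w (c *: h).
Proof.
move=> hh n; have [h1 h2] := hh n.
by rewrite coefZ1 coefZ2; split=> lt_w; rewrite ?(h1 lt_w) ?(h2 lt_w) scaler0.
Qed.

Lemma ord_geN w h : ord_ge w h -> ord_ge w (- h).
Proof. by rewrite -scaleN1r; apply: ord_geZ. Qed.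

Lemma ord_ge_sCM w r h : ord_ge w h -> ord_ge w (sC r * h).
Proof.
move=> hh n; rewrite sCM /= !coef_fpsCM; have [h1 h2] := hh n.
by split=> lt_w; rewrite ?(h1 lt_w) ?(h2 lt_w) mulr0.
Qed.

Lemma ord_ge_sXnM w j h : ord_ge w h -> ord_ge (w + j.*2) (sX ^+ j * h).
Proof.
move=> hh n; rewrite sXnM /= !coef_fpsXnM; case: (ltnP n j) => // le_jn.
have [h1 h2] := hh (n - j)%N.
by split=> lt_w; [apply: h1 | apply: h2]; lia.
Qed.

Lemma ord_ge_phiM w h : ord_ge w h -> ord_ge w.+1 (phi * h).
Proof. by move=> hh n; rewrite phiM /= ltnS; have [h1 _] := hh n. Qed.

Lemma ord_ge_dx w h : ord_ge w h -> ord_ge (w - 2) (dx h).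
Proof.
move=> hh n; rewrite /dx /fps_deriv /= !ltn_subRL !add2n -doubleS.
have [h1 h2] := hh n.+1.
by split=> lt_w; rewrite ?(h1 lt_w) ?(h2 lt_w) mul0rn.
Qed.

Lemma ord_ge_dphi w h : ord_ge w h -> ord_ge (w - 1) (dphi h).
Proof.
by move=> hh n; rewrite /dphi /= ltn_subRL add1n; have [_ h2] := hh n.
Qed.

Lemma ord_ge_opL w j h : ord_ge w h -> ord_ge (w + j.*2) (opL j h).
Proof.
move=> hh; apply/ord_geN/ord_geD.
  apply: ord_ge_le (ord_ge_sXnM j.+1 (ord_ge_dx hh)).
  by lia.
apply: ord_geZ; rewrite -mulrA.
apply: ord_ge_le (ord_ge_phiM (ord_ge_sXnM j (ord_ge_dphi hh))).
by lia.
Qed.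

Lemma ord_ge_opG w j h : ord_ge w h -> ord_ge (w + j.*2 - 1) (opG j h).
Proof.
move=> hh; apply: ord_geN; apply: ord_ge_le (_ : ord_ge ((w - 1) + j.*2) _).
  by lia.
apply/ord_ge_sXnM/ord_geD; first exact: ord_ge_dphi.
apply: ord_geN; apply: ord_ge_le (ord_ge_phiM (ord_ge_dx hh)).
by lia.
Qed.

Lemma ord_ge_summable F : (forall i, ord_ge i (F i)) -> summable F.
Proof.
move=> hF n; exists n.*2.+2 => i le_ni; have [h1 h2] := hF i n.
by split; [apply: h1 | apply: h2]; rewrite // (ltn_trans _ le_ni).
Qed.

Lemma ord_ge_formal_sum w F : summable F -> (forall i, ord_ge w (F i)) ->
  ord_ge w (formal_sum F).
Proof.
move=> hF hw n; have [N hN] := hF n.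
have [-> ->] := coef_formal_sum hF hN.
by split=> lt_w; rewrite big1 // => i _; have [h1 h2] := hw i n; auto.
Qed.

Lemma opT_ord AM w h i : ord_ge w h ->
  ord_ge (w.+1 + i) (sC (AM.1 i) * opL i.+1 h + sC (AM.2 i) * opG i.+1 h).
Proof.
move=> hh; apply: ord_geD; apply: ord_ge_sCM.
  apply: ord_ge_le (ord_ge_opL i.+1 hh).
  by lia.
apply: ord_ge_le (ord_ge_opG i.+1 hh).
by lia.
Qed.

Lemma ord_ge0 h : ord_ge 0 h.
Proof. by move=> n. Qed.

Lemma opT_summable AM h :
  summable (fun i => sC (AM.1 i) * opL i.+1 h + sC (AM.2 i) * opG i.+1 h).
Proof.
apply: ord_ge_summable => i; apply: ord_ge_le (opT_ord AM i (ord_ge0 h)).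
by rewrite leq_addl.
Qed.

Lemma ord_ge_opT AM w h : ord_ge w h -> ord_ge w.+1 (opT AM h).
Proof.
move=> hh; apply: ord_ge_formal_sum (opT_summable AM h) _ => i.
by apply: ord_ge_le (opT_ord AM i hh); rewrite leq_addr.
Qed.

Lemma ord_ge_iter AM w h n :
  ord_ge w h -> ord_ge (n + w) (iter n (fun k => - opT AM k) h).
Proof. by move=> hh; elim: n => //= n IHn; apply/ord_geN/ord_ge_opT. Qed.

Lemma expT_summable AM h :
  summable (fun n => (n`!%:R^-1 : rat) *: iter n (fun k => - opT AM k) h).
Proof.
apply: ord_ge_summable => n; apply: ord_geZ; rewrite -[X in ord_ge X]addn0.
exact/ord_ge_iter/ord_ge0.
Qed.

Definition phi_mul (H : sseries R * sseries R) : sseries R * sseries R :=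
  (phi * H.1, phi * H.2).

Lemma phi_expT AM :
  phi_mul (even_series (coefE_even AM), odd_series (coefE_odd AM)) =
  phi_mul (expT AM sX, expT AM phi).
Proof.
have low w h n : ord_ge w h -> (n.*2 <= w)%N -> (expT AM h).1 n = h.1 n.
  move=> hh le_nw; have [N hN] := expT_summable AM h n.
  have [|-> _] := coef_formal_sum (N := N.+1) (expT_summable AM h) (n := n).
    by move=> i /ltnW; apply: hN.
  rewrite big_ord_recl big1 => [|i _]; last first.
    have [h1 _] := ord_geZ ((lift ord0 i)`!%:R^-1 : rat) (ord_ge_iter AM (lift ord0 i) hh) n.
    by apply: h1; rewrite lift0; lia.
  by rewrite /= fact0 invr1 scale1r addr0.
have ordX : ord_ge 2 sX by case=> [|n]; split.
have ordphi : ord_ge 1 phi by case=> [|n]; split.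
congr (_, _); rewrite /= !phiM; congr (_, _).
  rewrite even_seriesE; apply/funext => -[|[|n]] //=.
    by rewrite (low 2).
  by rewrite (low 2).
by rewrite odd_seriesE; apply/funext => -[|n] //=; rewrite (low 1%N).
Qed.

Definition superconformal (H : sseries R * sseries R) : Prop :=
  let: ((f, xi), (psi, g)) := H in
  [/\ forall n, [/\ f n \in homog R false, g n \in homog R false,
                    xi n \in homog R true & psi n \in homog R true],
      xi = g * psi,
      g ^+ 2 = fps_deriv f + psi * fps_deriv psi
    & ((g, fps_deriv psi) : sseries R) <> 0].

Definition even_phi_coef (H : sseries R * sseries R) : R := H.2.2 0%N.

Definition Etilde AM : sseries R * sseries R :=
  xget 0 [set H | [/\ superconformal H, even_phi_coef H = 1
    & phi_mul H = phi_mul (even_series (coefE_even AM), odd_series (coefE_odd AM))]].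

Definition Ehat (aAM : R * ((nat -> R) * (nat -> R))) : sseries R * sseries R :=
  (sC (aAM.1 ^+ 2) * (Etilde aAM.2).1, sC aAM.1 * (Etilde aAM.2).2).

Definition superconformal_at (a : R) : set (sseries R * sseries R) :=
  [set H | [/\ superconformal H, even_phi_coef H = a
    & exists2 am, Rinf am & phi_mul H =
        phi_mul (sC (a ^+ 2) * even_series am.1, sC a * odd_series am.2)]].

End SuperSeries.

Arguments Rinf R _ : clear implicits.
Arguments even_units R _ : clear implicits.

(* Main.v *)
(* Give x weight 2, phi weight 1, A_j weight 2j and M_(j-1/2) weight 2j - 1.   *)
(* The operator in the exponential raises the weight, so E_j - A_j and         *)
(* E_(j-1/2) - M_(j-1/2) depend only on parameters of strictly lower weight,   *)
(* and the map (A, M) |-> E(A, M) is bijective by triangularity.  A            *)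
(* superconformal series normalized by g(0) = 1 is determined by its           *)
(* components (f, psi), because g is then the unique even square root of       *)
(* f' + psi psi' with constant term 1; this gives the bijectivity of           *)
(* E tilde.  Finally E hat is E tilde followed by the scaling                  *)
(* (f, psi) |-> (a^2 f, a psi), which acts on superconformal series and        *)
(* multiplies the even coefficient of phi by a, so that a can be recovered.    *)

Require Import Defs.
From mathcomp Require Import all_boot all_order all_algebra.
From mathcomp Require Import all_classical.
From mathcomp Require Import zify.

Set Implicit Arguments.
Unset Strict Implicit.
Unset Printing Implicit Defensive.

Import GRing.Theory.
Local Open Scope ring_scope.
Local Open Scope classical_set_scope.

(** [Etilde] is a composite of two bijections. The first, [Ecoef], sends (A, M) to the coefficients
    E(A, M). If two parameter pairs agree below weight w, their exponentials differ by [- opT] of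
    the difference, up to terms of higher order ([expT_sub]); evaluated at x and phi, this linear
    term reads off the parameters of weight w themselves. So the equation E(A, M) = t can be solved
    one weight at a time ([causal_fixpoint], [Ecoef_bij]). The second completes (f, psi) to a
    normalized superconformal series: xi = g psi is forced, and g is an even square root, which the
    same recursion shows to exist uniquely ([feven_sqrt], [normalized_at_ex]). For [Ehat], a unit a
    is read off as the even coefficient of phi, and scaling by its inverse returns to the normalized
    case ([scaling_bij]). *)

(** * Fixed points of causal maps on sequences *)

Section CausalFixpoint.
Variables (T : Type) (Q : nat -> T -> Prop) (S : (nat -> T) -> nat -> T).
Hypothesis S_stable :
  forall u, (forall n, Q n (u n)) -> forall n, Q n (S u n).
Hypothesis S_causal : forall u v n, (forall i, Q i (u i)) ->
  (forall i, Q i (v i)) -> (forall i, (i < n)%N -> u i = v i) -> S u n = S v n.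

Lemma causal_fixpoint_unique u v : (forall i, Q i (u i)) ->
  (forall i, Q i (v i)) -> S u = u -> S v = v -> u = v.
Proof.
move=> Qu Qv fu fv; apply/funext; elim/ltn_ind => n IHn.
by rewrite -fu -fv; apply: S_causal.
Qed.

Lemma causal_fixpoint u0 : (forall i, Q i (u0 i)) ->
  exists2 u, forall i, Q i (u i) & S u = u.
Proof.
move=> Q0; pose v k := iter k S u0.
have Qv k i : Q i (v k i) by elim: k i => [|k IHk] i //; apply: S_stable.
have stepv k i : (i < k)%N -> v k.+1 i = v k i.
  elim: k i => // k IHk i le_ik; apply: (S_causal (Qv k.+1) (Qv k)) => j lt_ji.
  by apply: IHk; apply: leq_trans lt_ji _.
have stabv k i : (i < k)%N -> v k i = v i.+1 i.
  move=> /subnKC <-; elim: (k - _)%N => [|d IHd]; first by rewrite addn0.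
  by rewrite addnS stepv // leq_addr.
exists (fun n => v n.+1 n) => //; apply/funext => n.
by apply: (S_causal _ (Qv n)) => // i lt_in; rewrite stabv.
Qed.

End CausalFixpoint.

Lemma set_bij_inverse (T U : Type) (t0 : T) (A : set T) (B : set U) (f : T -> U) :
  set_bij A B f -> exists g : U -> T,
    (forall y, B y -> A (g y) /\ f (g y) = y) /\ (forall x, A x -> g (f x) = x).
Proof.
case=> funf injf surjf.
have /choice[g gP] y : exists x, B y -> A x /\ f x = y.
  have [By|nBy] := pselect (B y); last by exists t0 => /nBy.
  by have [x Ax fx] := surjf y By; exists x.
exists g; split=> // x Ax; have [Agx fgx] := gP _ (funf x Ax).
by apply: injf; rewrite ?inE.
Qed.

(** * Parity of series and even square roots *)

Section Homogeneous.
Variable R : superalgebra.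
Implicit Types (r s : R) (f g : fps R) (h k : sseries R).

Lemma even_central r s : r \in homog R false -> r * s = s * r.
Proof.
move=> hr; rewrite (even_odd s) mulrDl mulrDr.
rewrite (supercomm hr (even_part_homog s)) (supercomm hr (odd_part_homog s)).
by rewrite !mul1r.
Qed.

Definition fhomog (p : bool) f : Prop := forall n, f n \in homog R p.

Lemma fhomogM p q f g : fhomog p f -> fhomog q g -> fhomog (p (+) q) (f * g).
Proof. by move=> hf hg n; rewrite coef_fpsM rpred_sum // => i _; apply: homogM. Qed.

Lemma fhomogD p f g : fhomog p f -> fhomog p g -> fhomog p (f + g).
Proof. by move=> hf hg n; apply: rpredD. Qed.

Lemma fhomog_deriv p f : fhomog p f -> fhomog p (fps_deriv f).
Proof. by move=> hf n; rewrite rpredMn. Qed.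

Lemma fhomogC p r : r \in homog R p -> fhomog p (fpsC r).
Proof. by move=> hr n; rewrite /fpsC rpredMn. Qed.

Lemma feven_central f g : fhomog false f -> f * g = g * f.
Proof.
move=> hf; apply/funext => n; rewrite !coef_fpsM (reindex_inj rev_ord_inj) /=.
apply: eq_bigr => i _; have le_in : (i <= n)%N by rewrite -ltnS.
by rewrite (even_central _ (hf _)) subSS subKn.
Qed.

Lemma fpsCM r s : fpsC (r * s) = fpsC r * fpsC s.
Proof. by apply/funext => n; rewrite coef_fpsCM /fpsC mulrnAr. Qed.

(** The square roots of c are the fixed points of g + (c - g^2)/2, a causal map on series with
    constant term 1. *)
Lemma feven_sqrt (c : fps R) : fhomog false c -> c 0%N = 1 ->
  exists! g : fps R, [/\ fhomog false g, g 0%N = 1 & g ^+ 2 = c].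
Proof.
move=> hc c0.
pose Q n (r : R) := r \in homog R false /\ (n = 0%N -> r = 1).
(* On series with constant term 1, coefficient n > 0 of [g ^+ 2] is [2 * g n] *)
(* plus terms in earlier coefficients: halving makes [S] causal.              *)
pose S (g : fps R) : fps R := g + (2%:R^-1 : rat) *: (c - g ^+ 2).
have half2 (r : R) : (2%:R^-1 : rat) *: (r + r) = r.
  by rewrite -mulr2n -scaler_nat scalerA mulVf ?scale1r.
have fixS g : S g = g <-> g ^+ 2 = c.
  split=> [|e]; last by rewrite /S e subrr scaler0 addr0.
  move=> /(canRL (addKr g)); rewrite addNr => /(congr1 ( *:%R (2%:R : rat))).
  by rewrite scalerA divff ?scale1r // scaler0 => /subr0_eq.
have QE g : (forall n, Q n (g n)) <-> fhomog false g /\ g 0%N = 1.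
  split=> [Qg|[hg g0] n]; last by split=> // ->.
  by split=> [n|]; [have [] := Qg n | apply: (Qg 0%N).2].
have S_stable g : (forall n, Q n (g n)) -> forall n, Q n (S g n).
  rewrite !QE => -[hg g0]; split=> [n|].
    apply: rpredD => //; apply: rpredZ; apply: homogB => //.
    exact: (fhomogM hg hg).
  transitivity (g 0%N + (2%:R^-1 : rat) *: (c 0%N - (g * g) 0%N)) => //.
  by rewrite coef_fpsM big_ord1 g0 c0 mulr1 subrr scaler0 addr0.
have S_causal g g' n : (forall i, Q i (g i)) -> (forall i, Q i (g' i)) ->
    (forall i, (i < n)%N -> g i = g' i) -> S g n = S g' n.
  rewrite !QE => -[hg g0] [hg' g'0] eqg.
  have SE (k : fps R) :
      S k n = k n + (2%:R^-1 : rat) *: (c n - (k * k) n) by [].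
  case: n eqg SE => [_ SE|n eqg SE].
    by rewrite !SE !coef_fpsM !big_ord1 g0 g'0.
  (* Without its two end terms, the convolution for coefficient n + 1 only involves the indices 1 to
     n. *)
  have mid : \sum_(i < n) g (bump 0 i) * g (n.+1 - bump 0 i)%N =
             \sum_(i < n) g' (bump 0 i) * g' (n.+1 - bump 0 i)%N.
    by apply: eq_bigr => i _; have lt_in := ltn_ord i; rewrite !eqg // /bump; lia.
  have sqE (k : fps R) : k 0%N = 1 -> (k * k) n.+1 =
      (k n.+1 + k n.+1) + \sum_(i < n) k (bump 0 i) * k (n.+1 - bump 0 i)%N.
    move=> k0; rewrite coef_fpsM big_ord_recl big_ord_recr /=.
    by rewrite subnn k0 mul1r mulr1 addrC -addrA addrC addrA.
  rewrite (SE g) (SE g') !sqE // mid !opprD (addrCA (c _)) (addrCA (c _)).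
  by rewrite -!opprD !(scalerDr _ (- _)) !scalerN !half2 !addNKr.
have [|g /QE[hg g0] /fixS gg] := causal_fixpoint S_stable S_causal (u0 := fpsC 1).
  by apply/QE; split; [exact: (fhomogC (homog1 R))|].
exists g; split=> // g' [hg' g'0 gg'].
by apply: (causal_fixpoint_unique S_causal);
  [apply/QE|apply/QE|apply/fixS|apply/fixS].
Qed.

(** Total parity of u + phi v: phi is odd, so v has the opposite parity. *)
Definition shomog (p : bool) h : Prop := fhomog p h.1 /\ fhomog (~~ p) h.2.

Lemma shomogD p h k : shomog p h -> shomog p k -> shomog p (h + k).
Proof. by case=> ? ? [? ?]; split; apply: fhomogD. Qed.

Lemma shomogZ p (c : rat) h : shomog p h -> shomog p (c *: h).
Proof. by case=> h1 h2; split=> n; apply: rpredZ. Qed.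

Lemma shomogN p h : shomog p h -> shomog p (- h).
Proof. by rewrite -scaleN1r; apply: shomogZ. Qed.

Lemma shomog_sXnM p j h : shomog p h -> shomog p (sX R ^+ j * h).
Proof.
case=> h1 h2; split=> n; rewrite sXnM /= coef_fpsXnM; case: ifP => // _.
  exact: rpred0.
exact: rpred0.
Qed.

Lemma parity_homog p r : r \in homog R p -> parity r \in homog R p.
Proof. by case: p => hr; rewrite ?(parity_odd hr) ?(parity_even hr) ?homogN. Qed.

Lemma shomog_sCM p q r h :
  r \in homog R p -> shomog q h -> shomog (p (+) q) (sC r * h).
Proof.
move=> hr [h1 h2]; rewrite sCM; split; first exact/fhomogM/h1/fhomogC.
by rewrite -addbN; apply: fhomogM h2; apply/fhomogC/parity_homog.
Qed.

Lemma shomog_phiM p h : shomog p h -> shomog (~~ p) (phi R * h).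
Proof. by case=> h1 h2; rewrite phiM; split; rewrite ?negbK // => n; apply: rpred0. Qed.

Lemma shomog_dx p h : shomog p h -> shomog p (dx h).
Proof. by case=> h1 h2; split; apply: fhomog_deriv. Qed.

Lemma shomog_dphi p h : shomog p h -> shomog (~~ p) (dphi h).
Proof. by case=> h1 h2; split=> // n; apply: rpred0. Qed.

Lemma shomog_opL p j h : shomog p h -> shomog p (opL j h).
Proof.
move=> hh; apply/shomogN/shomogD; first exact/shomog_sXnM/shomog_dx.
rewrite -mulrA; apply: shomogZ; rewrite -[p]negbK.
exact/shomog_phiM/shomog_sXnM/shomog_dphi.
Qed.

Lemma shomog_opG p j h : shomog p h -> shomog (~~ p) (opG j h).
Proof.
move=> hh; apply/shomogN/shomog_sXnM/shomogD; first exact: shomog_dphi.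
exact/shomogN/shomog_phiM/shomog_dx.
Qed.

Lemma shomog_formal_sum p (F : nat -> sseries R) :
  summable F -> (forall i, shomog p (F i)) -> shomog p (formal_sum F).
Proof.
move=> hF hh; split=> n; have [N hN] := hF n;
  have [e1 e2] := coef_formal_sum hF hN; rewrite ?e1 ?e2 rpred_sum // => i _.
  by have [] := hh i.
by have [] := hh i.
Qed.

(** Even A_j multiply the even operators L_j and odd M_(j-1/2) the odd operators G_(j-1/2), so every
    term of the exponent preserves parity. *)
Lemma shomog_expT p AM h : Rinf R AM -> shomog p h -> shomog p (expT AM h).
Proof.
move=> hAM hh; apply: shomog_formal_sum (expT_summable AM h) _ => n.
apply: shomogZ; elim: n => //= n IHn; apply/shomogN.
apply: shomog_formal_sum (opT_summable _ _) _ => i.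
have [hA hM] := hAM i; apply: shomogD.
  exact: (shomog_sCM hA (shomog_opL _ IHn)).
by have := shomog_sCM hM (shomog_opG i.+1 IHn); rewrite addbN negbK.
Qed.

Lemma shomog_sX : shomog false (sX R).
Proof.
by split=> n /=; [rewrite rpredMn ?homog1 | apply: rpred0].
Qed.

Lemma shomog_phi : shomog true (phi R).
Proof. by split=> /=; [move=> n; apply: rpred0 | apply/fhomogC/homog1]. Qed.

Lemma Rinf_coefE AM : Rinf R AM -> Rinf R (coefE_even AM, coefE_odd AM).
Proof.
move=> hAM i; split=> /=.
  exact: (shomog_expT hAM shomog_sX).1.
exact: (shomog_expT hAM shomog_phi).1.
Qed.

End Homogeneous.

(** * The exponential to leading order *)

Section Triangularity.
Variable R : superalgebra.
Implicit Types (h k : sseries R) (AM BN : (nat -> R) * (nat -> R)).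

Lemma summableB (F G : nat -> sseries R) :
  summable F -> summable G -> summable (fun i => F i - G i).
Proof.
move=> hF hG n; have [N1 h1] := hF n; have [N2 h2] := hG n.
exists (maxn N1 N2) => i; rewrite geq_max => /andP[/h1[a1 a2] /h2[b1 b2]].
by rewrite !(coefD1, coefD2) -scaleN1r coefZ1 coefZ2 a1 a2 b1 b2 scaler0 addr0.
Qed.

Lemma formal_sumB (F G : nat -> sseries R) : summable F -> summable G ->
  formal_sum (fun i => F i - G i) = formal_sum F - formal_sum G.
Proof.
move=> hF hG; apply: formal_sumE => n.
have [N1 h1] := summable_is_formal_sum hF n.
have [N2 h2] := summable_is_formal_sum hG n.
exists (maxn N1 N2) => m; rewrite geq_max => /andP[/h1[a1 a2] /h2[b1 b2]].
rewrite sumrB -!scaleN1r !(coefD1, coefD2, coefZ1, coefZ2).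
by rewrite a1 a2 b1 b2.
Qed.

Lemma coef_formal_sum1 (F : nat -> sseries R) n j (r : R) : summable F ->
  (forall i, (F i).1 n = r *+ (i == j)) -> (formal_sum F).1 n = r.
Proof.
move=> hF hr; have [N hN] := hF n.
have [|-> _] := coef_formal_sum (N := maxn N j.+1) hF (n := n).
  by move=> i; rewrite geq_max => /andP[/hN].
have lt_j : (j < maxn N j.+1)%N by rewrite leq_max leqnn orbT.
rewrite (bigD1 (Ordinal lt_j)) //= hr eqxx big1 ?addr0 // => i.
by rewrite -val_eqE /= hr => /negPf ->.
Qed.

Lemma formal_sum_delta j h :
  let F i := if i == j then h else 0 in summable F /\ formal_sum F = h.
Proof.
have hF : summable (fun i => if i == j then h else 0).
  by move=> n; exists j.+1 => i lt_ji; rewrite gtn_eqF.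
split=> //; apply: formal_sumE => n; exists j.+1 => m lt_jm.
rewrite (bigD1 (Ordinal lt_jm)) //= eqxx big1 ?addr0 // => i.
by rewrite -val_eqE /= => /negPf ->.
Qed.

Lemma dxB h k : dx (h - k) = dx h - dx k.
Proof.
by congr (_, _); apply/funext => n; rewrite /fps_deriv /= mulrnBl.
Qed.

Lemma dphiB h k : dphi (h - k) = dphi h - dphi k.
Proof. by congr (_, _); rewrite /= subr0. Qed.

Lemma opLB j h k : opL j (h - k) = opL j h - opL j k.
Proof. by rewrite /opL dxB dphiB !mulrBr scalerBr !opprD !opprK addrACA. Qed.

Lemma opGB j h k : opG j (h - k) = opG j h - opG j k.
Proof.
rewrite /opG dxB dphiB -opprD -mulrBr; congr (- (_ * _)).
by rewrite mulrBr !opprD !opprK addrACA.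
Qed.

Lemma sCB (r s : R) : sC (r - s) = sC r - sC s.
Proof.
by congr (_, _); rewrite /= ?subr0 //; apply/funext => n; rewrite /fpsC mulrnBl.
Qed.

Lemma opTB AM h k : opT AM (h - k) = opT AM h - opT AM k.
Proof.
rewrite -formal_sumB; try exact: opT_summable.
congr formal_sum; apply/funext => i.
by rewrite opLB opGB !mulrBr opprD addrACA.
Qed.

Definition AM_sub AM BN : (nat -> R) * (nat -> R) :=
  (fun i => AM.1 i - BN.1 i, fun i => AM.2 i - BN.2 i).

Lemma opT_AM_sub AM BN h : opT (AM_sub AM BN) h = opT AM h - opT BN h.
Proof.
rewrite -formal_sumB; try exact: opT_summable.
congr formal_sum; apply/funext => i.
by rewrite !sCB !mulrBl opprD addrACA.
Qed.

(* [A_j] has weight 2j and [M_(j - 1/2)] has weight 2j - 1, with the indices  *)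
(* shifted as in [Rinf].                                                      *)
Definition AM_ge (w : nat) AM : Prop := forall i,
  ((i.+1.*2 < w)%N -> AM.1 i = 0) /\ ((i.*2.+1 < w)%N -> AM.2 i = 0).

(** L_j raises the order by 2j and G_(j-1/2) by 2j - 1, exactly the weights of their parameters. *)
Lemma AM_ge_opT v w AM h :
  AM_ge w AM -> ord_ge v h -> ord_ge (v + w) (opT AM h).
Proof.
move=> hAM hh; apply: ord_ge_formal_sum (opT_summable AM h) _ => i.
have sC0 k : sC 0 * k = 0.
  have -> : sC 0 = 0 :> sseries R by rewrite -(subrr 0) sCB subrr.
  by rewrite mul0r.
have ord0 : ord_ge (v + w) (0 : sseries R) by [].
have [hA hM] := hAM i; apply: ord_geD.
  have [/hA -> |le_w] := ltnP i.+1.*2 w; first by rewrite sC0.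
  apply/ord_ge_sCM/ord_ge_le/ord_ge_opL/hh; lia.
have [/hM -> |le_w] := ltnP i.*2.+1 w; first by rewrite sC0.
apply/ord_ge_sCM/ord_ge_le/ord_ge_opG/hh; lia.
Qed.

Let T AM h := - opT AM h.

Lemma AM_ge_iter v w AM BN h n :
  AM_ge w (AM_sub AM BN) -> ord_ge v h -> (0 < n)%N ->
  ord_ge (v + w + n.-1) (iter n (T AM) h - iter n (T BN) h).
Proof.
move=> hw hh; case: n => // n _; elim: n => [|n IHn].
  have -> : iter 1 (T AM) h - iter 1 (T BN) h = - opT (AM_sub AM BN) h.
    by rewrite opT_AM_sub opprB [LHS]addrC [X in X + _]opprK.
  by rewrite addn0; apply: ord_geN; apply: AM_ge_opT.
rewrite [n.+2.-1]/= iterS [iter n.+2 (T BN) h]iterS.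
set p := iter n.+1 (T AM) h; set q := iter n.+1 (T BN) h.
(* Telescoping: the first summand gains one order over the previous difference, the second has an
   already iterated argument. *)
have -> : T AM p - T BN q = - (opT AM (p - q) + opT (AM_sub AM BN) q).
  by rewrite opTB opT_AM_sub addrA subrK opprB [LHS]addrC [X in X + _]opprK.
apply/ord_geN/ord_geD.
  by rewrite addnS; apply: ord_ge_opT IHn.
apply: ord_ge_le (AM_ge_opT hw (ord_ge_iter BN n.+1 hh)).
by lia.
Qed.

(** In the difference of the exponential series, the terms of index 0 cancel, those of index 1 give
    [- opT] of the parameter difference, and all later ones have order above v + w. *)
Lemma expT_sub v w AM BN h : AM_ge w (AM_sub AM BN) -> ord_ge v h ->
  ord_ge (v + w).+1 (expT AM h - expT BN h + opT (AM_sub AM BN) h).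
Proof.
move=> hw hh; set t := opT _ h.
(* The linear term becomes a formal sum supported at index 1, so that everything can be compared
   term by term. *)
have [hF hFt] := formal_sum_delta 1 (- t).
rewrite -[t]opprK -hFt -formal_sumB; try exact: expT_summable.
have hE := summableB (expT_summable AM h) (expT_summable BN h).
rewrite -formal_sumB //; apply: ord_ge_formal_sum => [|[|[|n]]].
- exact: summableB.
- by rewrite /= subrr subr0.
- rewrite /= (_ : 1`! = 1)%N // invr1 !scale1r /t opT_AM_sub !opprK addrACA.
  by rewrite addNr subrr addr0.
- rewrite /= subr0 -scalerBr; apply: ord_geZ.
  by apply: ord_ge_le (AM_ge_iter hw hh (ltn0Sn n.+1)); lia.
Qed.

End Triangularity.

(** * Bijectivity of the coefficient map *)

Section CoefficientMap.
Variable R : superalgebra.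
Implicit Types (AM BN : (nat -> R) * (nat -> R)) (u v : nat -> R).

Lemma fps_derivX : fps_deriv (fpsX R) = 1.
Proof. by apply/funext => -[|n]; rewrite /fps_deriv /fpsX //= mul0rn. Qed.

Lemma fps_derivC (r : R) : fps_deriv (fpsC r) = 0.
Proof. by apply/funext => n; rewrite /fps_deriv /fpsC /= mulr0n mul0rn. Qed.

Lemma fps_deriv0 : fps_deriv (0 : fps R) = 0.
Proof. by apply/funext => n; apply: mul0rn. Qed.

Lemma dx_sX : dx (sX R) = 1.
Proof. by rewrite /dx /= fps_derivX fps_deriv0. Qed.

Lemma dx_phi : dx (phi R) = 0.
Proof. by rewrite /dx /= (fps_derivC 1) fps_deriv0. Qed.

Lemma coef_sC_sXn (r : R) j n : (sC r * - sX R ^+ j).1 n = - r *+ (n == j).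
Proof. by rewrite mulrN -scaleN1r coefZ1 (sCXn r j n).1 scaleN1r mulNrn. Qed.

Lemma coef_opT_sX AM i : (opT AM (sX R)).1 i.+2 = - AM.1 i.
Proof.
apply: (coef_formal_sum1 (j := i)) (opT_summable AM (sX R)) _ => j.
have -> : opL j.+1 (sX R) = - sX R ^+ j.+2.
  by rewrite /opL dx_sX mulr1 (_ : dphi (sX R) = 0) // mulr0 scaler0 addr0.
rewrite coefD1 coef_sC_sXn !eqSS eq_sym.
have -> : (sC (AM.2 j) * opG j.+1 (sX R)).1 i.+2 = 0.
  have -> : opG j.+1 (sX R) = sX R ^+ j.+1 * phi R.
    by rewrite /opG dx_sX mulr1 (_ : dphi (sX R) = 0) // sub0r mulrN opprK.
  by rewrite sXnM sCM /= mulr0 coef_fpsCM mulr0.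
by rewrite addr0; case: eqP => [->|].
Qed.

Lemma coef_opT_phi AM i : (opT AM (phi R)).1 i.+1 = - AM.2 i.
Proof.
apply: (coef_formal_sum1 (j := i)) (opT_summable AM (phi R)) _ => j.
have -> : opG j.+1 (phi R) = - sX R ^+ j.+1.
  by rewrite /opG dx_phi mulr0 subr0 (_ : dphi (phi R) = 1) // mulr1.
rewrite coefD1 coef_sC_sXn !eqSS eq_sym.
have -> : (sC (AM.1 j) * opL j.+1 (phi R)).1 i.+1 = 0.
  rewrite /opL dx_phi mulr0 add0r -mulrA phiM -scaleNr sCM /=.
  by rewrite coef_fpsCM scaler0 mulr0.
by rewrite add0r; case: eqP => [->|].
Qed.

Lemma ord_ge_sX : ord_ge 2 (sX R).
Proof. by case=> [|n]; split. Qed.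

Lemma ord_ge_phi : ord_ge 1 (phi R).
Proof. by case=> [|n]; split. Qed.

(** The monomial x^(i+2) has weight 2 + 2(i+1), just below the order of the error in [expT_sub], so
    only the linear term is seen. *)
Lemma coefE_even_sub AM BN i : AM_ge i.+1.*2 (AM_sub AM BN) ->
  coefE_even AM i - coefE_even BN i = AM.1 i - BN.1 i.
Proof.
move=> hAM; have [e _] := expT_sub hAM ord_ge_sX i.+2.
apply/subr0_eq; rewrite -[X in _ + X](coef_opT_sX (AM_sub AM BN)).
by apply: e; lia.
Qed.

Lemma coefE_odd_sub AM BN i : AM_ge i.*2.+1 (AM_sub AM BN) ->
  coefE_odd AM i - coefE_odd BN i = AM.2 i - BN.2 i.
Proof.
move=> hAM; have [e _] := expT_sub hAM ord_ge_phi i.+1.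
apply/subr0_eq; rewrite -[X in _ + X](coef_opT_phi (AM_sub AM BN)).
by apply: e; lia.
Qed.

(* Interleaving the two sequences by increasing weight. *)
Definition AM_of u : (nat -> R) * (nat -> R) :=
  (fun i => u i.*2.+1, fun i => u i.*2).

Definition seq_of AM (n : nat) : R := if odd n then AM.1 n./2 else AM.2 n./2.

Lemma AM_ofK : cancel AM_of seq_of.
Proof.
move=> u; apply/funext => n; rewrite /seq_of /= -[n in RHS]odd_double_half.
by case: ifP.
Qed.

Lemma seq_ofK : cancel seq_of AM_of.
Proof.
case=> A M; congr (_, _); apply/funext => i; rewrite /seq_of /= odd_double /=.
  by rewrite uphalf_double.
by rewrite doubleK.
Qed.

Lemma Rinf_AM_of u :
  Rinf R (AM_of u) <-> forall n, u n \in homog R (~~ odd n).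
Proof.
split=> [h n|h i]; last first.
  by split; [have := h i.*2.+1 | have := h i.*2]; rewrite /= odd_double.
rewrite -(AM_ofK u) /seq_of; case: ifP => _.
  by have [] := h n./2.
by have [] := h n./2.
Qed.

(** Entry i of the interleaved sequence has weight i + 1. *)
Lemma AM_ge_AM_of u v n : (forall i, (i < n)%N -> u i = v i) ->
  AM_ge n.+1 (AM_sub (AM_of u) (AM_of v)).
Proof.
by move=> e i; split=> lt_i /=; rewrite e ?subrr //; lia.
Qed.

Definition Ecoef AM : (nat -> R) * (nat -> R) := (coefE_even AM, coefE_odd AM).

(* [Ecoef] is the identity plus terms of lower weight, so in the interleaved  *)
(* coordinates [u |-> u + (t - Ecoef u)] is causal; its fixed points are the   *)
(* preimages of [t].                                                          *)
Lemma Ecoef_bij : set_bij (Rinf R) (Rinf R) Ecoef.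
Proof.
pose S t u : nat -> R := fun n => u n + (seq_of t n - seq_of (Ecoef (AM_of u)) n).
have fixS t u : S t u = u -> Ecoef (AM_of u) = t.
  move=> e; apply: (can_inj seq_ofK); apply/funext => n; apply/esym/subr0_eq.
  by apply: (addrI (u n)); rewrite addr0; have := congr1 (@^~ n) e.
have Sfix t AM : Ecoef AM = t -> S t (seq_of AM) = seq_of AM.
  by move=> <-; apply/funext => n; rewrite /S seq_ofK subrr addr0.
pose Q n (r : R) : Prop := r \in homog R (~~ odd n).
have S_stable t : Rinf R t ->
    forall u, (forall n, Q n (u n)) -> forall n, Q n (S t u n).
  rewrite -{1}(seq_ofK t) => /Rinf_AM_of ht u hu n.
  apply: rpredD; first exact: hu.
  apply: homogB; first exact: ht.
  by move: n; apply/Rinf_AM_of; rewrite seq_ofK; apply/Rinf_coefE/Rinf_AM_of.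
have S_causal t u v n : (forall i, Q i (u i)) -> (forall i, Q i (v i)) ->
    (forall i, (i < n)%N -> u i = v i) -> S t u n = S t v n.
  move=> _ _ /AM_ge_AM_of hAM; apply/subr0_eq; rewrite /S.
  (* When u and v agree below n, their images differ at n by exactly u n - v n, so the correction
     cancels the dependence on entry n. *)
  have cancel_t (a b c d r : R) : c - d = a - b -> a + (r - c) - (b + (r - d)) = 0.
    move=> eq_cd; rewrite opprD addrACA -eq_cd opprB -(addrC (- c)).
    by rewrite addrACA addKr addNKr subrr.
  apply: cancel_t.
  change (seq_of (Ecoef (AM_of u)) n - seq_of (Ecoef (AM_of v)) n = u n - v n).
  rewrite -[n in RHS]odd_double_half /seq_of.
  move: hAM; rewrite -{1}[n]odd_double_half.
  by case: (odd n) => /= hAM; [apply: coefE_even_sub | apply: coefE_odd_sub].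
split.
- by move=> AM; apply: Rinf_coefE.
- move=> AM BN; rewrite !inE => hAM hBN e; apply: (can_inj seq_ofK).
  apply: (causal_fixpoint_unique (Q := Q) (S_causal (Ecoef BN))).
  + by apply/Rinf_AM_of; rewrite seq_ofK.
  + by apply/Rinf_AM_of; rewrite seq_ofK.
  + exact: Sfix e.
  + exact: Sfix (erefl (Ecoef BN)).
- move=> t ht.
  have [|u Qu /fixS e] :=
      causal_fixpoint (S_stable t ht) (S_causal t) (u0 := fun=> 0).
    by move=> i; apply: rpred0.
  by exists (AM_of u) => //; apply/Rinf_AM_of.
Qed.

End CoefficientMap.

(** * Normalized superconformal series *)

Section SuperconformalSeries.
Variable R : superalgebra.
Implicit Types (AM : (nat -> R) * (nat -> R)) (H K : sseries R * sseries R).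

Lemma phi_mulP H K : phi_mul H = phi_mul K <-> H.1.1 = K.1.1 /\ H.2.1 = K.2.1.
Proof.
rewrite /phi_mul !phiM; split=> [[-> ->] //|[e1 e2]].
by rewrite e1 e2.
Qed.

Lemma even_series_homog AM : Rinf R AM -> fhomog false (even_series AM.1).1.
Proof.
move=> hAM [|[|n]]; rewrite even_seriesE /= ?rpred0 ?homog1 //.
by have [] := hAM n.
Qed.

Lemma odd_series_homog AM : Rinf R AM -> fhomog true (odd_series AM.2).1.
Proof.
move=> hAM [|n]; rewrite odd_seriesE /= ?rpred0 //.
by have [] := hAM n.
Qed.

Definition normalized_at AM H : Prop :=
  [/\ superconformal H, even_phi_coef H = 1
    & phi_mul H = phi_mul (even_series AM.1, odd_series AM.2)].

Lemma normalized_at_ex AM : Rinf R AM -> exists! H, normalized_at AM H.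
Proof.
move=> hAM; have hf := even_series_homog hAM; have hpsi := odd_series_homog hAM.
set f := (even_series AM.1).1 in hf; set psi := (odd_series AM.2).1 in hpsi.
have hc : fhomog false (fps_deriv f + psi * fps_deriv psi).
  by apply: fhomogD (fhomog_deriv hf) (fhomogM hpsi (fhomog_deriv hpsi)).
(* f starts with x and psi has no constant term. *)
have c0 : (fps_deriv f + psi * fps_deriv psi) 0%N = 1.
  have -> : 1 = fps_deriv f 0%N + (psi * fps_deriv psi) 0%N; last by [].
  rewrite coef_fpsM big_ord1 /fps_deriv /f /psi even_seriesE odd_seriesE /=.
  by rewrite mul0r addr0.
have [g [[hg g0 gg] uniq_g]] := feven_sqrt hc c0.
exists ((f, g * psi), (psi, g)); split=> [|[[f' xi] [psi' g']]].
  split=> //; last exact/phi_mulP.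
  split=> // [n|[g_eq0 _]].
    split; [exact: hf | exact: hg | exact: (fhomogM hg hpsi) | exact: hpsi].
  by move/eqP: g0; rewrite g_eq0 eq_sym oner_eq0.
case=> -[hom -> gg' _] g'0 /phi_mulP[/= ef epsi].
have hg' : fhomog false g' by move=> n; have [] := hom n.
move: gg'; rewrite -/f -/psi in ef epsi; rewrite ef epsi => gg'.
by rewrite (uniq_g g').
Qed.

(** A normalized completion exists, so [xget] does not fall back on its default [0]. *)
Lemma Etilde_normalized AM : Rinf R AM -> normalized_at (Ecoef AM) (Etilde AM).
Proof.
move=> /Rinf_coefE/normalized_at_ex[H [hH _]].
exact: (@xgetPex _ 0 (normalized_at (Ecoef AM)) (ex_intro _ H hH)).
Qed.

Lemma series_pair_inj AM AM' :
  phi_mul (even_series AM.1, odd_series AM.2) =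
  phi_mul (even_series AM'.1, odd_series AM'.2) -> AM = AM'.
Proof.
move=> /phi_mulP[e1 e2].
have {}e1 : (even_series AM.1).1 = (even_series AM'.1).1 := e1.
have {}e2 : (odd_series AM.2).1 = (odd_series AM'.2).1 := e2.
move: e1 e2; rewrite !even_seriesE !odd_seriesE => e1 e2.
rewrite (surjective_pairing AM) (surjective_pairing AM').
congr (_, _); apply/funext => i.
  by have := congr1 (@^~ i.+2) e1.
by have := congr1 (@^~ i.+1) e2.
Qed.

Lemma sC1M (h : sseries R) : sC 1 * h = h.
Proof. by rewrite -[RHS]mul1r; congr (_ * _). Qed.

Lemma superconformal_at1P H :
  superconformal_at 1 H <-> exists2 AM, Rinf R AM & normalized_at AM H.
Proof.
split=> [[hH H1 [AM hAM eH]]|[AM hAM [hH H1 eH]]].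
  by exists AM => //; split=> //; rewrite eH expr1n !sC1M.
by split=> //; exists AM => //; rewrite eH expr1n !sC1M.
Qed.

Lemma Etilde_bij : set_bij (Rinf R) (superconformal_at (1 : R)) (@Etilde R).
Proof.
have [funE injE surjE] := Ecoef_bij R; split.
- move=> AM hAM; apply/superconformal_at1P; exists (Ecoef AM); first exact: funE.
  exact: Etilde_normalized.
- move=> AM BN; rewrite !inE => hAM hBN e.
  have [_ _ eA] := Etilde_normalized hAM; have [_ _ eB] := Etilde_normalized hBN.
  apply: injE; [by rewrite inE | by rewrite inE | apply: series_pair_inj].
  exact: etrans (esym eA) (etrans (congr1 (@phi_mul R) e) eB).
- move=> H /superconformal_at1P[am ham hH]; have [AM hAM eAM] := surjE am ham.
  exists AM => //; have [K [_ uK]] := normalized_at_ex ham.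
  by rewrite -(uK H hH) (uK (Etilde AM)) // -eAM; apply: Etilde_normalized.
Qed.

(** * Scaling by even units *)

Definition scaling (a : R) H : sseries R * sseries R :=
  (sC (a ^+ 2) * H.1, sC a * H.2).

Lemma sC_mul (a b : R) : sC (a * b) = sC a * sC b.
Proof. by rewrite sCM /= mulr0 -fpsCM. Qed.

Lemma scaling_mul (a b : R) H : a \in homog R false ->
  scaling a (scaling b H) = scaling (a * b) H.
Proof.
move=> ha; rewrite /scaling /= !mulrA -!sC_mul; congr (sC _ * _, _).
by rewrite !expr2 -!mulrA; congr (a * _); rewrite !mulrA (even_central b ha).
Qed.

Lemma scaling1 H : scaling 1 H = H.
Proof. by case: H => h k; rewrite /scaling expr1n !sC1M. Qed.

Lemma scaling_inv (a b : R) H : a \in homog R false -> a * b = 1 ->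
  scaling a (scaling b H) = H.
Proof. by move=> ha ab; rewrite scaling_mul // ab scaling1. Qed.

Lemma homogXn2 (a : R) : a \in homog R false -> a ^+ 2 \in homog R false.
Proof. by move=> ha; rewrite expr2; apply: (homogM ha ha). Qed.

Lemma even_phi_coef_scaling (a : R) H : a \in homog R false ->
  even_phi_coef (scaling a H) = a * even_phi_coef H.
Proof.
move=> ha; transitivity ((fpsC (parity a) * H.2.2) 0%N).
  by rewrite /even_phi_coef /scaling (sCM a).
by rewrite coef_fpsCM parity_even.
Qed.

Lemma fps_deriv_fpsCM (a : R) (f : fps R) :
  fps_deriv (fpsC a * f) = fpsC a * fps_deriv f.
Proof.
by apply/funext => n; rewrite coef_fpsCM /fps_deriv coef_fpsCM mulrnAr.
Qed.

(** Both superconformal equations are homogeneous: f and xi are multiplied by a^2, psi and g by a,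
    hence each side by a^2. The hypothesis on the coefficient of phi secures the nonvanishing
    condition. *)
Lemma superconformal_scaling (a : R) H : a \in homog R false ->
  even_phi_coef (scaling a H) <> 0 -> superconformal H ->
  superconformal (scaling a H).
Proof.
move=> ha nz; have haa := homogXn2 ha.
case: H nz => [[f xi] [psi g]] nz [hom exi gg _].
have hca := fhomogC ha; have hcaa := fhomogC haa.
move: nz; rewrite /scaling !sCM /= (parity_even ha) (parity_even haa) => nz.
have cross (u v : fps R) : fpsC (a ^+ 2) * (u * v) = fpsC a * u * (fpsC a * v).
  rewrite expr2 fpsCM !mulrA; congr (_ * _).
  by rewrite -!mulrA; congr (_ * _); rewrite (feven_central u hca).
split.
- move=> n; have [h1 h2 h3 h4] := hom n; rewrite !coef_fpsCM.
  by split; [exact: (homogM haa h1) | exact: (homogM ha h2)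
            | exact: (homogM haa h3) | exact: (homogM ha h4)].
- by rewrite exi cross.
- by rewrite !fps_deriv_fpsCM -cross -mulrDr -gg [in RHS]expr2 cross expr2.
- by case=> e _; apply: nz; rewrite /even_phi_coef /= e.
Qed.

Lemma superconformal_at_scaling (a c : R) H : a \in homog R false ->
  a * c <> 0 -> superconformal_at c H -> superconformal_at (a * c) (scaling a H).
Proof.
move=> ha nz [hH Hc [AM hAM eH]].
have Hac : even_phi_coef (scaling a H) = a * c by rewrite even_phi_coef_scaling ?Hc.
split=> //; first by apply: superconformal_scaling => //; rewrite Hac.
exists AM => //; move/phi_mulP: eH => -[e1 e2].
have {}e1 : H.1.1 = fpsC (c ^+ 2) * (even_series AM.1).1 := e1.
have {}e2 : H.2.1 = fpsC c * (odd_series AM.2).1 := e2.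
apply/phi_mulP; split.
  change (fpsC (a ^+ 2) * H.1.1 = fpsC ((a * c) ^+ 2) * (even_series AM.1).1).
  rewrite e1 mulrA -fpsCM; congr (fpsC _ * _).
  by rewrite !expr2 -!mulrA; congr (a * _); rewrite !mulrA (even_central c ha).
change (fpsC a * H.2.1 = fpsC (a * c) * (odd_series AM.2).1).
by rewrite e2 mulrA -fpsCM.
Qed.

Lemma scaling_bij (T : Type) (A : set T) (F : T -> sseries R * sseries R) :
  set_bij A (superconformal_at (1 : R)) F ->
  set_bij (even_units R `*` A) (\bigcup_(a in even_units R) superconformal_at a)
    (fun p => scaling p.1 (F p.2)).
Proof.
case=> funF injF surjF; split.
- move=> [a x] [/= ua Ax]; have [ha [b _ [ab _]]] := ua.
  exists a => //=; rewrite -[a in X in X _]mulr1.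
  apply: superconformal_at_scaling (funF x Ax) => //.
  by rewrite mulr1 => a0; move/eqP: ab; rewrite a0 mul0r eq_sym oner_eq0.
- move=> [a x] [b y]; rewrite !inE => -[/= ua Ax] [/= ub Ay] e.
  have [ha [a' ha' [_ a'a]]] := ua; have [hb _] := ub.
  have [_ x1 _] := funF x Ax; have [_ y1 _] := funF y Ay.
  have eab : a = b.
    have := congr1 (@even_phi_coef R) e.
    by rewrite !even_phi_coef_scaling // x1 y1 !mulr1.
  rewrite -eab in e *; congr (_, _); apply: injF; rewrite ?inE //.
  by rewrite -(scaling_inv (F x) ha' a'a) e scaling_inv.
- move=> H [a ua hH]; have [ha [b hb [ab ba]]] := ua.
  (* Scaling by the inverse b of a normalizes H. *)
  have /surjF[x Ax ex] : superconformal_at 1 (scaling b H).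
    rewrite -ba; apply: superconformal_at_scaling => //.
    by rewrite ba; apply/eqP/oner_neq0.
  by exists (a, x) => //=; rewrite ex scaling_inv.
Qed.

End SuperconformalSeries.

Theorem proposition3p10 (R : superalgebra) :
  [/\ set_bij (even_units R `*` Rinf R)
        (\bigcup_(a in even_units R) superconformal_at a) (@Ehat R),
      set_bij (Rinf R) (superconformal_at (1 : R)) (@Etilde R),
      exists Ehat_inv : sseries R * sseries R -> R * ((nat -> R) * (nat -> R)),
        [/\ forall H, (\bigcup_(a in even_units R) superconformal_at a) H ->
              (even_units R `*` Rinf R) (Ehat_inv H) /\ Ehat (Ehat_inv H) = H
          & forall aAM, (even_units R `*` Rinf R) aAM ->
              Ehat_inv (Ehat aAM) = aAM]
    & exists Etilde_inv : sseries R * sseries R -> (nat -> R) * (nat -> R),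
        [/\ forall H, superconformal_at (1 : R) H ->
              Rinf R (Etilde_inv H) /\ Etilde (Etilde_inv H) = H
          & forall AM, Rinf R AM -> Etilde_inv (Etilde AM) = AM] ].
Proof.
(* [Ehat] unfolds to [scaling] of [Etilde], so [bE] is the claim about [Ehat]. *)
have bT := Etilde_bij R; have bE := scaling_bij bT.
have [Einv [E1 E2]] := set_bij_inverse 0 bE.
have [Tinv [T1 T2]] := set_bij_inverse 0 bT.
by split=> //; [exists Einv | exists Tinv].
Qed.
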